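(* Let $E\in\{\mathscr D,\mathscr S\}$, $\gamma\in C(0)$, and let $f_0\in E'$ be a convolution multiplier on $E$. For every $U\in\mathcal N(E)$ there is a $V\in\mathcal N(E)$ such that $$f_0\ast f\in E^{(\gamma,V)}\quad\text{for all }f\in E^{(\gamma,U)},$$ $$f_0\ast f\in[E^{(\gamma,V)}]\quad\text{for all }f\in[E^{(\gamma,U)}].$$
   Context: Test function spaces on $\mathbb R^n$ ($n\ge1$), over $\mathbb C$: for $m\in\mathbb N$, $\mathscr D_m$ is the Fréchet space of infinitely differentiable $\xi:\mathbb R^n\to\mathbb C$ with $\xi(x)=0$ for $|x|>m$, with norms $\|\xi\|_p=\sup_{|x|\le m}\max_{|q|\le p}|D^q\xi(x)|$; $\mathscr D=\bigcup_{m\ge1}\mathscr D_m$ is the strict inductive limit; $\mathscr S$ is the Fréchet space of infinitely differentiable rapidly decreasing functions with norms $\|\xi\|_p=\sup_{|k|,|q|\le p,\,x\in\mathbb R^n}|x^kD^q\xi(x)|$. $E'$ is the space of continuous linear functionals on $E$. $\mathcal N(E)$ is the family of neighborhoods of $0$ in $E$. $C(0)$ is the set of functions $\gamma:\mathbb C\to\mathbb C$ with $\lim_{t\to0}\gamma(t)=\gamma(0)=0$ and $|\gamma(t)|\ge|t|$ for $|t|\le1$. For $\gamma\in C(0)$ and $U\in\mathcal N(E)$, $E^{(\gamma,U)}$ (demi-distributions) is the set of continuous $f:E\to\mathbb C$ with $f(0)=0$ such that for all $x\in E$, $u\in U$ and scalars $|t|\le1$ there are scalars $r,s$ with $|r-1|\le|\gamma(t)|$,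 $|s|\le|\gamma(t)|$ and $f(x+tu)=rf(x)+sf(u)$. $[E^{(\gamma,U)}]$ is its linear span in $\mathbb C^E$. $f_0\in E'$ is a convolution multiplier on $E$ if (i) for each $\xi\in E$ the function $f_0\ast\xi:\mathbb R^n\to\mathbb C$, $(f_0\ast\xi)(x)=f_0(\xi(x+\cdot))$, belongs to $E$; and (ii) $f_0\ast\xi_k\to0$ in $E$ whenever $\xi_k\to0$ in $E$ (sequences). For a convolution multiplier $f_0$ and $f\in[E^{(\gamma,U)}]$, $f_0\ast f:E\to\mathbb C$ is defined by $(f_0\ast f)(\xi)=f(f_0\ast\xi)$. *)

(* Defs.v *)
From HB Require Import structures.
From mathcomp Require Import all_boot all_order all_algebra.
From mathcomp Require Import all_classical all_reals all_analysis.
From mathcomp Require Import complex.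
From mathcomp Require Import ring lra.
Set Implicit Arguments.
Unset Strict Implicit.
Unset Printing Implicit Defensive.
Import Order.TTheory GRing.Theory Num.Theory.
Import numFieldNormedType.Exports.
Import Normc.
Local Open Scope classical_set_scope.
Local Open Scope ring_scope.
Local Open Scope complex_scope.

Section locally_convex_base.
Context (K : numFieldType) (E : lmodType K).

Definition absolutely_convex (W : set E) :=
  forall (a b : K) (x y : E), `|a| + `|b| <= 1 -> W x -> W y ->
    W (a *: x + b *: y).

Definition nbhs_translate (N : set_system E) (x : E) : set_system E :=
  [set A | N [set h | A (x + h)]].

(* The conditions under which N is the system of neighborhoods of 0 of a
   locally convex topology. *)
Record locally_convex_base (N : set_system E) : Prop := LocallyConvexBase {
  lcb_filter : Filter N;
  lcb_absconv : forall U, N U ->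
    exists W, [/\ N W, absolutely_convex W & W `<=` U];
  lcb_scale : forall U (c : K), N U -> N [set x | U (c *: x)];
  lcb_absorb : forall U (x : E), N U -> exists2 t : K, t != 0 & U (t *: x)
}.

Variables (N : set_system E) (NP : locally_convex_base N).
Let NF := lcb_filter NP.
#[local] Existing Instance NF.

Let lcbS (U V : set E) : N U -> (forall h, U h -> V h) -> N V.
Proof. by move=> NU UV; exact: filterS UV NU. Qed.

Let half : K := 2^-1.

Let half_gt0 : 0 < half. Proof. by rewrite invr_gt0. Qed.

Let halfD : half + half = 1.
Proof. by rewrite /half -mulr2n -[RHS](@mulfV _ 2) ?pnatr_eq0// mulr_natl. Qed.

Let half2 : half * 2 = 1.
Proof. by rewrite mulVf ?pnatr_eq0. Qed.

Let absconv_scale (W : set E) (c : K) (x : E) :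
  absolutely_convex W -> `|c| <= 1 -> W x -> W (c *: x).
Proof.
move=> Wac c1 Wx; rewrite -[_ *: _]addr0 -(scale0r x).
by apply: (Wac c 0 x x) => //; rewrite normr0 addr0.
Qed.

Let lcb_zero (U : set E) : N U -> U 0.
Proof.
move=> /(lcb_absconv NP)[W [NW Wac WU]]; apply: WU.
have [t _ Wt] := lcb_absorb NP 0 NW.
by rewrite scaler0 in Wt.
Qed.

Let lcb_half (U : set E) : N U -> exists2 V, N V &
  forall x y, V x -> V y -> U (x + y).
Proof.
move=> /(lcb_absconv NP)[W [NW Wac WU]].
exists [set x | W (2 *: x)]; first exact: (lcb_scale NP 2 NW).
move=> x y /= Wx Wy; apply: WU.
rewrite -[x]scale1r -[y]scale1r -half2 -!scalerA.
by apply: (Wac half half) => //; rewrite gtr0_norm// halfD.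
Qed.

Lemma nbhs_translate_filter (x : E) : ProperFilter (nbhs_translate N x).
Proof.
split; first by move=> /lcb_zero.
split.
- exact: filterT.
- by move=> A B NA NB; exact: filterI.
- by move=> A B AB; apply: filterS => h; exact: AB.
Qed.

Lemma nbhs_translate_singleton (x : E) (A : set E) :
  nbhs_translate N x A -> A x.
Proof. by move=> /lcb_zero/=; rewrite addr0. Qed.

Lemma nbhs_translate_nbhs (x : E) (A : set E) : nbhs_translate N x A ->
  nbhs_translate N x [set y | nbhs_translate N y A].
Proof.
move=> /lcb_half[V NV VA]; rewrite /nbhs_translate/=.
apply: (lcbS NV) => h Vh; apply: (lcbS NV) => k Vk /=.
by rewrite -addrA; exact: VA.
Qed.

Lemma nbhs_translate_add (x y : E) (A : set E) : nbhs_translate N (x + y) A ->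
  exists B C, [/\ nbhs_translate N x B, nbhs_translate N y C &
    forall u v, B u -> C v -> A (u + v)].
Proof.
move=> /lcb_half[V NV VA].
exists [set u | V (u - x)], [set v | V (v - y)]; split.
- rewrite /nbhs_translate; apply: (lcbS NV) => h Vh.
  by rewrite /= [x + h]addrC addrK.
- rewrite /nbhs_translate; apply: (lcbS NV) => h Vh.
  by rewrite /= [y + h]addrC addrK.
- move=> u v /= Vu Vv; have := VA _ _ Vu Vv => /=.
  by rewrite addrACA [x + _]addrC [y + _]addrC !subrK.
Qed.

Lemma nbhs_translate_scale (c : K) (x : E) (A : set E) :
  nbhs_translate N (c *: x) A ->
  exists (d : K) B, [/\ 0 < d, nbhs_translate N x B &
    forall e u, `|c - e| < d -> B u -> A (e *: u)].
Proof.
move=> /(lcb_absconv NP)[W [NW Wac WA]].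
have [t t0 Wt] := lcb_absorb NP x NW.
pose M : K := `|c| + 1.
have M0 : 0 < M by rewrite ltr_wpDl.
pose a : K := half * `|t|.
have a0 : 0 < a by rewrite mulr_gt0// normr_gt0.
exists (a / (a + 1)), [set u | W ((2 * M) *: (u - x))].
have a10 : 0 < a + 1 by rewrite addr_gt0.
split; first by rewrite divr_gt0.
  rewrite /nbhs_translate/=.
  apply: (lcbS (lcb_scale NP (2 * M) NW)) => h /= Wh.
  by rewrite [x + h]addrC addrK.
move=> e u ce Wu.
have ce1 : `|e - c| < 1.
  rewrite distrC (lt_le_trans ce)// ler_pdivrMr// mul1r lerDl//.
have cea : `|e - c| <= a.
  rewrite distrC (le_trans (ltW ce))// ler_pdivrMr// ler_peMr ?(ltW a0)//.
  by rewrite lerDr ltW.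
have eM : `|e| <= M.
  by rewrite -[e](subrK c) addrC (le_trans (ler_normD _ _))// lerD2l ltW.
rewrite -[u](subrK x).
have -> : e *: (u - x + x) = c *: x +
    (half *: ((2 * (e - c) / t) *: (t *: x)) +
     half *: ((e / M) *: ((2 * M) *: (u - x)))).
  rewrite !scalerA.
  have -> : half * (2 * (e - c) / t) * t = e - c.
    by rewrite mulrA -mulrA mulVf// mulr1 mulrA half2 mul1r.
  have -> : half * (e / M) * (2 * M) = e.
    rewrite [half * _]mulrC -mulrA [half * _]mulrA half2 mul1r -mulrA.
    by rewrite mulVf ?mulr1// gt_eqF.
  by rewrite addrA -scalerDl [c + _]addrC [e - c + c]subrK -scalerDr [x + _]addrC.
apply: (WA (half *: _ + half *: _)); apply: (Wac half half).
- by rewrite gtr0_norm// halfD.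
- apply: absconv_scale => //; rewrite normrM normfV ler_pdivrMr ?normr_gt0//.
  rewrite mul1r normrM normr_nat -(@ler_pM2l _ half)//.
  by rewrite mulrA half2 mul1r.
- apply: absconv_scale => //; rewrite normrM normfV (gtr0_norm M0).
  by rewrite ler_pdivrMr// mul1r.
Qed.

Lemma nbhs_translate_convex (x : E) (A : set E) : nbhs_translate N x A ->
  exists B, [/\ forall (l : K) (u v : E), 0 <= l -> l <= 1 ->
      B u -> B v -> B (l *: u + (1 - l) *: v),
    B `<=` (fun y => nbhs_translate N y B), B x & B `<=` A].
Proof.
move=> /(lcb_absconv NP)[W [NW Wac WA]].
pose B0 := [set y | W (y - x)].
have B0c (l : K) (u v : E) : 0 <= l -> l <= 1 ->
    B0 u -> B0 v -> B0 (l *: u + (1 - l) *: v).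
  move=> l0 l1 Wu Wv; rewrite /B0/=.
  have -> : l *: u + (1 - l) *: v - x = l *: (u - x) + (1 - l) *: (v - x).
    by rewrite !scalerBr addrACA -opprD -scalerDl [l + _]addrC subrK scale1r.
  apply: (Wac l (1 - l)) => //.
  by rewrite !ger0_norm ?subr_ge0// addrC subrK.
exists [set y | nbhs_translate N y B0]; split.
- move=> l u v l0 l1 /= Bu Bv; rewrite /nbhs_translate/=.
  have NBuv : N ([set h | B0 (u + h)] `&` [set h | B0 (v + h)]).
    exact: (@filterI _ N NF [set h | B0 (u + h)] [set h | B0 (v + h)] Bu Bv).
  apply: (lcbS NBuv) => h /= [uh vh].
  have := B0c l (u + h) (v + h) l0 l1 uh vh.
  by rewrite !scalerDr addrACA -[X in _ + X]scalerDl [l + _]addrC subrK scale1r.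
- by move=> y /nbhs_translate_nbhs.
- rewrite /= /nbhs_translate/=; apply: (lcbS NW) => h Wh.
  by rewrite /B0/= [x + h]addrC addrK.
- move=> y /nbhs_translate_singleton Wy.
  by have := WA _ Wy; rewrite /= [x + _]addrC subrK.
Qed.

End locally_convex_base.

Section smooth_functions.
Context (R : realType) (n : nat).
Local Notation C := R[i].
Implicit Types (f g : 'rV[R]_n -> C) (x y : 'rV[R]_n) (q k : 'I_n -> nat).

Definition enorm x : R := Num.sqrt (\sum_i x 0 i ^+ 2).

(* R[i] is not a normed R-module in the library, so partial derivatives of
   complex-valued functions are taken on real and imaginary parts. *)
Definition pderiv (i : 'I_n) f : 'rV[R]_n -> C := fun x =>
  'D_(delta_mx 0 i) (fun y => complex.Re (f y)) x +i*
  'D_(delta_mx 0 i) (fun y => complex.Im (f y)) x.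

Definition iter_pderiv (s : seq 'I_n) f : 'rV[R]_n -> C := foldr pderiv f s.

Definition mdeg q : nat := (\sum_i q i)%N.

(* D^q f *)
Definition mpartial q f : 'rV[R]_n -> C :=
  iter_pderiv (flatten [seq nseq (q i) i | i <- enum 'I_n]) f.

Definition monomial k x : R := \prod_i x 0 i ^+ k i.

Definition cdifferentiable f := forall x,
  differentiable (fun y => complex.Re (f y)) x /\
  differentiable (fun y => complex.Im (f y)) x.

(* s ranges over all words in the coordinates, so that no order of
   differentiation is privileged. *)
Definition smooth f := forall s, cdifferentiable (iter_pderiv s f).

Definition supported_in (m : nat) f := forall x, m%:R < enorm x -> f x = 0.

(* Suprema are taken in \bar R: sup of an unbounded set in R is a junk value.
   Finiteness is lemma normD_fin for smooth functions, and part of the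
   definition of the rapidly decreasing functions for normS. *)
Definition normD (m p : nat) f : \bar R :=
  ereal_sup [set (normc (mpartial qx.1 f qx.2))%:E | qx in
    [set qx : ('I_n -> nat) * 'rV[R]_n | (mdeg qx.1 <= p)%N /\ enorm qx.2 <= m%:R]].

Definition normS (p : nat) f : \bar R :=
  ereal_sup [set (normc ((monomial kqx.1.1 kqx.2)%:C * mpartial kqx.1.2 f kqx.2))%:E
    | kqx in [set kqx : ('I_n -> nat) * ('I_n -> nat) * 'rV[R]_n |
       (mdeg kqx.1.1 <= p)%N /\ (mdeg kqx.1.2 <= p)%N]].

Let ReL (a b z w : C) : complex.Re (a * z + b * w) =
  complex.Re a * complex.Re z - complex.Im a * complex.Im z +
  (complex.Re b * complex.Re w - complex.Im b * complex.Im w).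
Proof. by case: a b z w => [? ?] [? ?] [? ?] [? ?]. Qed.

Let ImL (a b z w : C) : complex.Im (a * z + b * w) =
  complex.Re a * complex.Im z + complex.Im a * complex.Re z +
  (complex.Re b * complex.Im w + complex.Im b * complex.Re w).
Proof. by case: a b z w => [? ?] [? ?] [? ?] [? ?]. Qed.

Let lin4 (a1 a2 a3 a4 : R) (h f1 f2 f3 f4 : 'rV[R]_n -> R) x v :
  (forall y, h y = a1 * f1 y + a2 * f2 y + (a3 * f3 y + a4 * f4 y)) ->
  differentiable f1 x -> differentiable f2 x ->
  differentiable f3 x -> differentiable f4 x ->
  differentiable h x /\ 'D_v h x =
    a1 * 'D_v f1 x + a2 * 'D_v f2 x + (a3 * 'D_v f3 x + a4 * 'D_v f4 x).
Proof.
move=> hE d1 d2 d3 d4.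
have -> : h = ((a1 \*: f1) + (a2 \*: f2)) + ((a3 \*: f3) + (a4 \*: f4)).
  exact/funext.
have Z a u : differentiable u x -> differentiable (a \*: u : _ -> R) x.
  by move=> du; exact: differentiableZ.
split; first by apply: differentiableD; apply: differentiableD; apply: Z.
have DZ a u : differentiable u x -> derivable (a \*: u : _ -> R) x v.
  by move=> du; apply: diff_derivable; exact: Z.
rewrite deriveD; [|by apply: derivableD; apply: DZ..].
rewrite !deriveD; try exact: DZ.
by rewrite !deriveZ//; exact: diff_derivable.
Qed.

Let lincomb (a b : C) f g : 'rV[R]_n -> C := fun y => a * f y + b * g y.

Let lincomb_Re (a b : C) f g x v : cdifferentiable f -> cdifferentiable g ->
  let h := fun y => complex.Re (lincomb a b f g y) in
  differentiable h x /\ 'D_v h x =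
   complex.Re a * 'D_v (fun y => complex.Re (f y)) x +
   - complex.Im a * 'D_v (fun y => complex.Im (f y)) x +
   (complex.Re b * 'D_v (fun y => complex.Re (g y)) x +
   - complex.Im b * 'D_v (fun y => complex.Im (g y)) x).
Proof.
move=> df dg h; have [fr fi] := df x; have [gr gi] := dg x.
by apply: lin4 => // y; rewrite /h /lincomb ReL !mulNr.
Qed.

Let lincomb_Im (a b : C) f g x v : cdifferentiable f -> cdifferentiable g ->
  let h := fun y => complex.Im (lincomb a b f g y) in
  differentiable h x /\ 'D_v h x =
   complex.Re a * 'D_v (fun y => complex.Im (f y)) x +
   complex.Im a * 'D_v (fun y => complex.Re (f y)) x +
   (complex.Re b * 'D_v (fun y => complex.Im (g y)) x +
   complex.Im b * 'D_v (fun y => complex.Re (g y)) x).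
Proof.
move=> df dg h; have [fr fi] := df x; have [gr gi] := dg x.
by apply: lin4 => // y; rewrite /h /lincomb ImL.
Qed.

Lemma cdifferentiable_lin (a b : C) f g :
  cdifferentiable f -> cdifferentiable g -> cdifferentiable (lincomb a b f g).
Proof.
move=> df dg x; split.
- by have [] := lincomb_Re a b x 0 df dg.
- by have [] := lincomb_Im a b x 0 df dg.
Qed.

Lemma pderiv_lin (i : 'I_n) (a b : C) f g :
  cdifferentiable f -> cdifferentiable g ->
  pderiv i (lincomb a b f g) = lincomb a b (pderiv i f) (pderiv i g).
Proof.
move=> df dg; apply/funext => x.
have [_ r] := lincomb_Re a b x (delta_mx 0 i) df dg.
have [_ m] := lincomb_Im a b x (delta_mx 0 i) df dg.
rewrite /pderiv r m; apply/eqP; rewrite eq_complex /lincomb ReL ImL /=.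
by rewrite !mulNr !eqxx.
Qed.

Lemma iter_pderiv_lin s (a b : C) f g : smooth f -> smooth g ->
  iter_pderiv s (lincomb a b f g) =
  lincomb a b (iter_pderiv s f) (iter_pderiv s g).
Proof.
move=> sf sg; elim: s => [//|i s IH].
by rewrite /iter_pderiv/= -!/(iter_pderiv _ _) IH pderiv_lin.
Qed.

Lemma smooth_lin (a b : C) f g : smooth f -> smooth g ->
  smooth (lincomb a b f g).
Proof.
move=> sf sg s; rewrite iter_pderiv_lin//.
exact: (cdifferentiable_lin a b (sf s) (sg s)).
Qed.

Lemma mpartial_lin q (a b : C) f g x : smooth f -> smooth g ->
  mpartial q (lincomb a b f g) x = a * mpartial q f x + b * mpartial q g x.
Proof. by move=> sf sg; rewrite /mpartial iter_pderiv_lin. Qed.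

Lemma smooth0 : smooth (fun=> 0).
Proof.
have H s : iter_pderiv s (fun=> 0) = (fun=> 0).
  elim: s => [//|i s IH]; rewrite /iter_pderiv/= -/(iter_pderiv _ _) IH.
  apply/funext => x; rewrite /pderiv/=.
  by rewrite (_ : 'D_ _ _ x = 0)//; exact: derive_cst.
by move=> s x; rewrite H /=; split; exact: differentiable_cst.
Qed.

Definition translate x f : 'rV[R]_n -> C := fun y => f (x + y).

Lemma pderiv_translate (i : 'I_n) x f :
  pderiv i (translate x f) = translate x (pderiv i f).
Proof.
apply/funext => y.
have H (u : 'rV[R]_n -> R) :
    'D_(delta_mx 0 i) (fun z => u (x + z)) y = 'D_(delta_mx 0 i) u (x + y).
  rewrite /derive; set F := (X in lim (X @ _)); set G := (X in _ = lim (X @ _)).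
  by have -> : F = G by apply/funext => h; rewrite /F /G/= addrCA.
rewrite /pderiv /translate (H (fun z => complex.Re (f z))).
by rewrite (H (fun z => complex.Im (f z))).
Qed.

Lemma iter_pderiv_translate s x f :
  iter_pderiv s (translate x f) = translate x (iter_pderiv s f).
Proof.
by elim: s => [//|i s]; rewrite /iter_pderiv/= => ->; rewrite pderiv_translate.
Qed.

Lemma smooth_translate x f : smooth f -> smooth (translate x f).
Proof.
move=> sf s y; rewrite iter_pderiv_translate /translate.
have dt : differentiable (fun z => x + z) y.
  by apply: differentiableD; [exact: differentiable_cst|].
have [dr di] := sf s (x + y).
by split; [exact: (differentiable_comp dt dr)|exact: (differentiable_comp dt di)].
Qed.

End smooth_functions.

Section seminorms.
Context (R : realType) (n : nat).
Local Notation C := R[i].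
Implicit Types (f g : 'rV[R]_n -> C) (x y : 'rV[R]_n) (q k : 'I_n -> nat).

Let sup_lt I (P : set I) (v : I -> R) (e : R) :
  (ereal_sup [set (v i)%:E | i in P] < e%:E)%E <->
  exists2 r, r < e & forall i, P i -> v i <= r.
Proof.
split.
- move=> se.
  have ub i : P i -> ((v i)%:E <= ereal_sup [set (v i)%:E | i in P])%E.
    by move=> Pi; apply: ereal_sup_ubound; exists i.
  case: (ereal_sup _) se ub => [r| |] //.
  + by rewrite lte_fin => re ub; exists r => // i /ub; rewrite lee_fin.
  + move=> _ ub; exists (e - 1); first by rewrite ltrBlDr ltrDl.
    by move=> i /ub.
- move=> [r re vr]; apply: (@le_lt_trans _ _ r%:E); last by rewrite lte_fin.
  by apply: ge_ereal_sup => _ [i Pi <-]; rewrite lee_fin; exact: vr.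
Qed.

Let sup_fin I (P : set I) (v : I -> R) :
  (ereal_sup [set (v i)%:E | i in P] < +oo)%E <->
  exists r, forall i, P i -> v i <= r.
Proof.
split.
- move=> se.
  have : exists r : R, (ereal_sup [set (v i)%:E | i in P] < r%:E)%E.
    case: (ereal_sup _) se => [r| |] // _; last by exists 0; rewrite ltNyr.
    by exists (r + 1); rewrite lte_fin ltrDl.
  by move=> [r /sup_lt[s _ vs]]; exists s.
- move=> [r vr]; have : (ereal_sup [set (v i)%:E | i in P] < (r + 1)%:E)%E.
    by apply/sup_lt; exists r => //; rewrite ltrDl.
  by move/lt_trans; apply; rewrite ltry.
Qed.

Let normc_ge0 (z : C) : 0 <= normc z.
Proof. by case: z => a b; exact: sqrtr_ge0. Qed.

Let normcE (z : C) : `|z| = (normc z)%:C.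
Proof. by []. Qed.

Let normcD (z w : C) : normc (z + w) <= normc z + normc w.
Proof. exact: le_normcD. Qed.

Section abstract_seminorm.
Context (I : Type) (P : nat -> set I) (T : I -> ('rV[R]_n -> C) -> C).
Hypothesis P0 : forall p, P p !=set0.
Hypothesis Pmono : forall p p', (p <= p')%N -> P p `<=` P p'.
Hypothesis Tlin : forall i a b f g, smooth f -> smooth g ->
  T i (fun y => a * f y + b * g y) = a * T i f + b * T i g.
Let nrm p f := ereal_sup [set (normc (T i f))%:E | i in P p].

Lemma abstract_norm_mono p p' f : (p <= p')%N -> (nrm p f <= nrm p' f)%E.
Proof.
move=> pp'; apply: le_ereal_sup => _ [i Pi <-].
by exists i => //; exact: Pmono Pi.
Qed.

Let bound_ge0 p f r : (forall i, P p i -> normc (T i f) <= r) -> 0 <= r.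
Proof. by move=> B; have [i Pi] := P0 p; exact: le_trans (B i Pi). Qed.

Lemma abstract_norm_absconv p f g (a b : C) (e : R) :
  smooth f -> smooth g -> `|a| + `|b| <= 1 ->
  (nrm p f < e%:E)%E -> (nrm p g < e%:E)%E ->
  (nrm p (fun y => a * f y + b * g y)%R < e%:E)%E.
Proof.
move=> sf sg; rewrite !normcE -rmorphD -(rmorph1 (real_complex R)) lecR => ab.
move=> /sup_lt[r re fr] /sup_lt[s se gs]; apply/sup_lt.
exists (Num.max r s); first by rewrite gt_max re se.
move=> i Pi; rewrite Tlin// (le_trans (normcD _ _))// !normcM.
have m0 : 0 <= Num.max r s by rewrite le_max (bound_ge0 fr).
apply: (@le_trans _ _ ((normc a + normc b) * Num.max r s)).
  rewrite mulrDl lerD// ler_wpM2l// le_max ?fr// gs// orbT//.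
by rewrite ler_piMl.
Qed.

Lemma abstract_norm_scale p (c : C) (e : R) : 0 < e -> exists2 d : R, 0 < d &
  forall f, smooth f -> (nrm p f < d%:E)%E -> (nrm p (fun y => c * f y)%R < e%:E)%E.
Proof.
move=> e0; have c1 : 0 < normc c + 1 by rewrite ltr_wpDl.
exists (e / (normc c + 1)); first by rewrite divr_gt0.
move=> f sf /sup_lt[r re fr]; apply/sup_lt.
have r0 := bound_ge0 fr.
exists ((normc c + 1) * r); first by rewrite mulrC -ltr_pdivlMr.
move=> i Pi; have -> : T i (fun y => c * f y) = c * T i f.
  transitivity (c * T i f + 0 * T i f); last by rewrite mul0r addr0.
  rewrite -Tlin//; congr (T i _); apply/funext => y.
  by rewrite mul0r addr0.
rewrite normcM; apply: ler_pM => //; last exact: fr.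
by rewrite lerDl.
Qed.

Lemma abstract_norm_absorb p f (e : R) : 0 < e -> smooth f ->
  (nrm p f < +oo)%E ->
  exists2 t : C, t != 0 & (nrm p (fun y => t * f y)%R < e%:E)%E.
Proof.
move=> e0 sf /sup_fin[M fM].
have M0 := bound_ge0 fM.
have M1 : 0 < M + 1 by rewrite ltr_wpDl.
pose t := e / (M + 1); have t0 : 0 < t by rewrite divr_gt0.
exists t%:C; first by rewrite eq_complex/= eqxx andbT gt_eqF.
apply/sup_lt; exists (t * M).
  by rewrite /t mulrAC -mulrA -[ltRHS]mulr1 ltr_pM2l// ltr_pdivrMr// mul1r ltrDl.
move=> i Pi; have -> : T i (fun y => t%:C * f y) = t%:C * T i f.
  transitivity (t%:C * T i f + 0 * T i f); last by rewrite mul0r addr0.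
  rewrite -Tlin//; congr (T i _); apply/funext => y.
  by rewrite mul0r addr0.
rewrite normcM; apply: ler_pM => //; last exact: fM.
by rewrite /= expr0n/= addr0 sqrtr_sqr gtr0_norm.
Qed.

End abstract_seminorm.

Let mdeg_bound (B : ('I_n -> nat) -> R -> Prop) :
  (forall q r s, r <= s -> B q r -> B q s) ->
  (forall q, exists r, B q r) ->
  forall p, exists r, forall q, (mdeg q <= p)%N -> B q r.
Proof.
move=> Bmono /choice[M BM] p.
pose N := \sum_(t : {ffun 'I_n -> 'I_p.+1}) `|M (fun i => val (t i))|.
exists N => q qp.
pose t : {ffun 'I_n -> 'I_p.+1} := [ffun i => inord (q i)].
have qE : q = (fun i => val (t i)).
  apply/funext => i; rewrite ffunE/= inordK// ltnS (leq_trans _ qp)//.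
  by rewrite /mdeg (bigD1 i)//= leq_addr.
apply: (Bmono _ (M q)); last exact: BM.
rewrite /N (bigD1 t)//= -qE.
by rewrite (le_trans (ler_norm _))// lerDl sumr_ge0.
Qed.

Lemma mdeg0 : mdeg ((fun=> 0%N) : 'I_n -> nat) = 0%N.
Proof. by rewrite /mdeg big1. Qed.

Lemma enorm0 : enorm (0 : 'rV[R]_n) = 0.
Proof.
by rewrite /enorm big1 ?sqrtr0// => i _; rewrite mxE expr0n.
Qed.

Let coord_enorm x i : `|x 0 i| <= enorm x.
Proof.
rewrite -sqrtr_sqr ler_sqrt ?sqr_ge0// ?sumr_ge0// => [|j _]; last exact: sqr_ge0.
by rewrite (bigD1 i)//= lerDl sumr_ge0// => j _; exact: sqr_ge0.
Qed.

Let smooth_continuous f q : smooth f ->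
  continuous (fun x => `|complex.Re (mpartial q f x)| + `|complex.Im (mpartial q f x)|).
Proof.
move=> sf x; have [dr di] := sf (flatten [seq nseq (q i) i | i <- enum 'I_n]) x.
have cr := cvg_norm (differentiable_continuous dr).
have ci := cvg_norm (differentiable_continuous di).
exact: (cvgD (cr _) (ci _)).
Qed.

Let normc_le (z : C) : normc z <= `|complex.Re z| + `|complex.Im z|.
Proof.
case: z => a b /=; rewrite -[leRHS]ger0_norm ?addr_ge0// -sqrtr_sqr.
rewrite ler_sqrt ?sqr_ge0// sqrrD !real_normK ?num_real//.
by rewrite -addrA lerD2l lerDr mulrn_wge0// mulr_ge0.
Qed.

Lemma normD_fin (m p : nat) f : smooth f -> (normD m p f < +oo)%E.
Proof.
move=> sf; apply/sup_fin => /=.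
have qbound q : exists r, forall x, enorm x <= m%:R -> normc (mpartial q f x) <= r.
  pose A : set 'rV[R]_n := [set v | forall i, `[- m%:R : R, m%:R]%classic (v ord0 i)].
  have cA : compact A.
    apply: (@rV_compact _ n (fun=> `[- m%:R : R, m%:R]%classic)) => i.
    exact: segment_compact.
  have A0 : A 0 by move=> i /=; rewrite mxE in_itv/= oppr_le0 ler0n.
  have [c cAc cmax] := EVT_max_rV (ex_intro _ _ A0) cA
    (continuous_subspaceT (@smooth_continuous _ q sf)).
  eexists => x xm; apply: (le_trans (normc_le _)); apply: cmax.
  rewrite inE => i /=.
  by rewrite in_itv/= -ler_norml; exact: le_trans xm.
have [r Br] := @mdeg_bound
  (fun q r => forall x, enorm x <= m%:R -> normc (mpartial q f x) <= r)
  (fun q r s rs Br x xm => le_trans (Br x xm) rs) qbound p.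
by exists r => -[q x]/= [qp xm]; exact: Br.
Qed.

Definition rapid f := forall k, exists M,
  forall x, normc ((monomial k x)%:C * f x) <= M.

Lemma normS_fin f :
  (forall p, (normS p f < +oo)%E) <-> forall q, rapid (mpartial q f).
Proof.
split.
- move=> H q k; have /sup_fin[r Hr] := H (maxn (mdeg k) (mdeg q)).
  exists r => x; apply: (Hr (k, q, x)).
  by split; rewrite /= ?leq_maxl ?leq_maxr.
- move=> H p; apply/sup_fin.
  have [r Br] := @mdeg_bound
    (fun q r => forall k, (mdeg k <= p)%N ->
       forall x, normc ((monomial k x)%:C * mpartial q f x) <= r)
    (fun q r s rs Br k kp x => le_trans (Br k kp x) rs)
    (fun q => @mdeg_bound _
      (fun k r s rs Br x => le_trans (Br x) rs) (H q) p) p.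
  by exists r => -[[k q] x]/= [kp qp]; exact: Br.
Qed.

Let rapid_lin (a b : C) f g : rapid f -> rapid g ->
  rapid (fun x => a * f x + b * g x).
Proof.
move=> rf rg k; have [M HM] := rf k; have [N HN] := rg k.
exists (normc a * M + normc b * N) => x.
rewrite mulrDr (le_trans (normcD _ _))//.
rewrite !(mulrCA (monomial k x)%:C) ![normc (_ * ((monomial k x)%:C * _))]normcM.
by apply: lerD; apply: ler_wpM2l.
Qed.

Let rapid_coord i f : rapid f -> rapid (fun x => (x 0 i)%:C * f x).
Proof.
move=> rf k; have [M HM] := rf (fun j => k j + (j == i))%N.
exists M => x; rewrite mulrA -rmorphM/=.
suff <- : monomial (fun j => k j + (j == i))%N x = monomial k x * x 0 i by [].
rewrite /monomial (bigD1 i)//= [in RHS](bigD1 i)//= eqxx exprD expr1 -!mulrA.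
congr (_ * _); rewrite mulrC; congr (_ * _).
by apply: eq_bigr => j /negbTE ->; rewrite addn0.
Qed.

Let rapid_coordB x i f : rapid f -> rapid (fun z => ((z - x) 0 i)%:C * f z).
Proof.
move=> rf; have := rapid_lin 1 (- (x 0 i)%:C) (rapid_coord i rf) rf.
congr rapid; apply/funext => z.
by rewrite mul1r !mxE mulNr -mulrBl rmorphB.
Qed.

Let rapid_monomialB x k f : rapid f -> rapid (fun z => (monomial k (z - x))%:C * f z).
Proof.
move=> rf; rewrite /monomial.
elim: (index_enum _) => [|i s IH].
  rewrite (_ : (fun z => _) = f)//; apply/funext => z.
  by rewrite big_nil mul1r.
have [h hE] : exists h, h = fun z : 'rV[R]_n =>
    (\prod_(j <- s) (z - x) 0 j ^+ k j)%:C * f z by eexists.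
rewrite -hE in IH.
rewrite (_ : (fun z => _) = (fun z => ((z - x) 0 i ^+ k i)%:C * h z)); last first.
  by apply/funext => z; rewrite big_cons rmorphM/= hE -mulrA.
elim: (k i) => [|m IHm].
  rewrite (_ : (fun z => _) = h)//; apply/funext => z.
  by rewrite expr0 mul1r.
rewrite (_ : (fun z => _) =
    (fun z => ((z - x) 0 i)%:C * (((z - x) 0 i ^+ m)%:C * h z))).
  exact: rapid_coordB.
by apply/funext => z; rewrite exprS rmorphM/= -mulrA.
Qed.

Let monomial0 x : monomial (fun=> 0%N) x = 1.
Proof. by rewrite /monomial big1. Qed.

Lemma rapid_translate x f : rapid f -> rapid (translate x f).
Proof.
move=> rf k; have [M HM] := rapid_monomialB x k rf (fun=> 0%N).
exists M => y; have := HM (x + y).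
by rewrite monomial0 mul1r [x + y - x]addrC addKr.
Qed.

Lemma rapid_linear (a b : C) f g : rapid f -> rapid g ->
  rapid (fun x => a * f x + b * g x).
Proof. exact: rapid_lin. Qed.

Lemma rapid0 : rapid (fun=> 0).
Proof. by move=> k; exists 0 => x; rewrite mulr0 normc0. Qed.

Lemma mpartial_translate q x f :
  mpartial q (translate x f) = translate x (mpartial q f).
Proof. exact: iter_pderiv_translate. Qed.

Lemma enorm_translate x (m : nat) : exists2 m' : nat, (0 < m')%N &
  forall y, m'%:R < enorm y -> m%:R < enorm (x + y).
Proof.
have S0 (z : 'rV[R]_n) : 0 <= \sum_i z 0 i ^+ 2.
  by apply: sumr_ge0 => i _; exact: sqr_ge0.
pose B : R := 2 * m%:R ^+ 2 + 2 * \sum_i x 0 i ^+ 2.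
exists (Num.truncn B).+1 => // y ly.
rewrite ltNge; apply/negP => lxy.
have B0 : 0 <= B by rewrite addr_ge0 ?mulr_ge0 ?sqr_ge0.
have Bt : B < (Num.truncn B).+1%:R by exact: truncnS_gt.
have : \sum_i y 0 i ^+ 2 <= B.
  have : \sum_i (x + y) 0 i ^+ 2 <= m%:R ^+ 2.
    by rewrite -[leLHS]sqr_sqrtr ?S0// ler_sqr ?nnegrE ?sqrtr_ge0.
  rewrite /B => H; apply: (@le_trans _ _
      (2 * (\sum_i (x + y) 0 i ^+ 2) + 2 * \sum_i x 0 i ^+ 2)).
    rewrite !mulr_sumr -big_split/=; apply: ler_sum => i _; rewrite !mxE.
    rewrite -subr_ge0 (_ : _ - _ = (2 * x 0 i + y 0 i) ^+ 2) ?sqr_ge0//.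
    ring.
  by rewrite lerD2r ler_pM2l.
rewrite leNgt => /negP; apply.
rewrite -[ltRHS]sqr_sqrtr ?S0//.
have y1 : 1 <= enorm y by rewrite ltW// (le_lt_trans _ ly)// ler1n.
rewrite (lt_le_trans (lt_trans Bt ly))// ler_eXnr//.
Qed.

End seminorms.

(* The names of the two spaces: D and S. *)
Variant test_space := compactly_supported | rapidly_decreasing.

Section test_functions.
Context (R : realType) (n : nat).
Local Notation C := R[i].
Implicit Types (E : test_space) (f g : 'rV[R]_n -> C) (x y : 'rV[R]_n).

Definition is_test_fun E f : Prop :=
  match E with
  | compactly_supported =>
      smooth f /\ exists2 m : nat, (0 < m)%N & supported_in m f
  | rapidly_decreasing =>
      smooth f /\ forall p, (normS p f < +oo)%E
  end.

Definition test_pred E : pred ('rV[R]_n -> C) := fun f => `[< is_test_fun E f >].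

Lemma is_test_fun_lin E (a b : C) f g : is_test_fun E f -> is_test_fun E g ->
  is_test_fun E (fun y => a * f y + b * g y).
Proof.
case: E => /= -[sf ff] [sg gg]; (split; first exact: smooth_lin).
- have [m m0 fm] := ff; have [p p0 gp] := gg.
  exists (maxn m p); first by rewrite leq_max m0.
  move=> x lx; rewrite fm ?gp ?mulr0 ?addr0//.
    by apply: le_lt_trans lx; rewrite ler_nat leq_maxr.
  by apply: le_lt_trans lx; rewrite ler_nat leq_maxl.
- apply/normS_fin => q; have rf := (normS_fin f).1 ff q.
  have rg := (normS_fin g).1 gg q.
  rewrite (_ : mpartial q _ = fun y => a * mpartial q f y + b * mpartial q g y).
    exact: rapid_linear.
  by apply/funext => y; rewrite mpartial_lin.
Qed.

Lemma is_test_fun0 E : is_test_fun E (fun=> 0).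
Proof.
case: E => /=; (split; first exact: smooth0).
- by exists 1%N => // x.
- apply/normS_fin => q; rewrite (_ : mpartial q _ = fun=> 0); first exact: rapid0.
  apply/funext => y; transitivity
    (0 * mpartial q (fun=> 0) y + 0 * mpartial q (fun=> 0) y : C).
    rewrite -mpartial_lin; [|exact: smooth0..].
    by congr (mpartial q _ y); apply/funext => z; rewrite !mul0r addr0.
  by rewrite !mul0r addr0.
Qed.

Lemma is_test_fun_translate E x f : is_test_fun E f ->
  is_test_fun E (translate x f).
Proof.
case: E => /= -[sf ff]; (split; first exact: smooth_translate).
- have [m m0 fm] := ff; have [p p0 H] := enorm_translate x m.
  by exists p => // y /H; exact: fm.
- apply/normS_fin => q; rewrite mpartial_translate.
  exact/rapid_translate/(normS_fin f).1.
Qed.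

Lemma test_pred_submod E : submod_closed (test_pred E).
Proof.
split; first by apply/asboolP; exact: is_test_fun0.
move=> a f g /asboolP Ef /asboolP Eg; apply/asboolP.
have := is_test_fun_lin a 1 Ef Eg; congr is_test_fun.
by apply/funext => y; rewrite mul1r.
Qed.

HB.instance Definition _ E := GRing.isSubmodClosed.Build C ('rV[R]_n -> C)
  (test_pred E) (test_pred_submod E).

Record test_fun E := TestFun {
  test_val :> 'rV[R]_n -> C;
  _ : test_val \in test_pred E
}.

HB.instance Definition _ E := [isSub for @test_val E].
HB.instance Definition _ E := [Choice of test_fun E by <:].
HB.instance Definition _ E := [SubChoice_isSubLmodule of test_fun E by <:].

Lemma test_funP E (xi : test_fun E) : is_test_fun E xi.
Proof. by case: xi => f /= /asboolP. Qed.

Lemma test_fun_smooth E (xi : test_fun E) : smooth xi.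
Proof. by move: (test_funP xi); case: E xi => xi []. Qed.

Definition make_test_fun E f (Ef : is_test_fun E f) : test_fun E :=
  TestFun (introT (asboolP _) Ef : f \in test_pred E).

Definition test_translate E x (xi : test_fun E) : test_fun E :=
  make_test_fun (is_test_fun_translate x (test_funP xi)).

(* Neighborhoods of 0. For D this is the inductive limit topology: the finest
   locally convex one inducing on each D_m a topology coarser than that of the
   norms (normD m p)_p, hence the absolutely convex W whose trace on each D_m
   is a neighborhood of 0. *)
Definition test_nbhs0 E : set_system (test_fun E) :=
  match E with
  | compactly_supported => fun U => exists W, [/\ absolutely_convex W,
      W `<=` U &
      forall m : nat, (0 < m)%N -> exists (p : nat) (e : R), 0 < e /\
        forall xi : test_fun compactly_supported,
          supported_in m xi -> (normD m p xi < e%:E)%E -> W xi]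
  | rapidly_decreasing => fun U => exists (p : nat) (e : R), 0 < e /\
      forall xi : test_fun rapidly_decreasing, (normS p xi < e%:E)%E -> U xi
  end.

Let lin_valE E (a b : C) (xi eta : test_fun E) :
  (a *: xi + b *: eta : test_fun E) = (fun y => a * xi y + b * eta y) :> (_ -> _).
Proof. by []. Qed.

Let scale_valE E (a : C) (xi : test_fun E) :
  (a *: xi : test_fun E) = (fun y => a * xi y) :> (_ -> _).
Proof. by []. Qed.

Let ID := (('I_n -> nat) * 'rV[R]_n)%type.
Let PD (m p : nat) := [set qx : ID | (mdeg qx.1 <= p)%N /\ enorm qx.2 <= m%:R].
Let TD (qx : ID) f := mpartial qx.1 f qx.2.
Let IS := (('I_n -> nat) * ('I_n -> nat) * 'rV[R]_n)%type.
Let PS (p : nat) := [set kqx : IS | (mdeg kqx.1.1 <= p)%N /\ (mdeg kqx.1.2 <= p)%N].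
Let TS (kqx : IS) f := (monomial kqx.1.1 kqx.2)%:C * mpartial kqx.1.2 f kqx.2.

Let PD0 m p : PD m p !=set0.
Proof.
by exists ((fun=> 0%N), 0); split; rewrite /= ?mdeg0 ?enorm0 ?ler0n.
Qed.

Let PDmono m p p' : (p <= p')%N -> PD m p `<=` PD m p'.
Proof. by move=> pp' qx [qp xm]; split => //; exact: leq_trans pp'. Qed.

Let TDlin i a b f g : smooth f -> smooth g ->
  TD i (fun y => a * f y + b * g y) = a * TD i f + b * TD i g.
Proof. by move=> sf sg; exact: mpartial_lin. Qed.

Let PS0 p : PS p !=set0.
Proof. by exists ((fun=> 0%N), (fun=> 0%N), 0); split; rewrite /= mdeg0. Qed.

Let PSmono p p' : (p <= p')%N -> PS p `<=` PS p'.
Proof. by move=> pp' i [ip iq]; split; exact: leq_trans pp'. Qed.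

Let TSlin i a b f g : smooth f -> smooth g ->
  TS i (fun y => a * f y + b * g y) = a * TS i f + b * TS i g.
Proof.
move=> sf sg; rewrite /TS mpartial_lin// mulrDr.
by congr (_ + _); rewrite mulrCA.
Qed.

Let absconvS (p : nat) (e : R) : absolutely_convex
  [set xi : test_fun rapidly_decreasing | (normS p xi < e%:E)%E].
Proof.
move=> a b xi eta ab /= xie etae.
exact: (abstract_norm_absconv PS0 TSlin
  (test_fun_smooth xi) (test_fun_smooth eta) ab xie etae).
Qed.

Let baseS : locally_convex_base (@test_nbhs0 rapidly_decreasing).
Proof.
split.
- split.
  + by exists 0%N, 1.
  + move=> A B [p [e [e0 Ae]]] [q [d [d0 Bd]]].
    exists (maxn p q), (Num.min e d); split; first by rewrite lt_min e0.
    move=> xi; rewrite EFin_min lt_min => /andP[xe xd]; split.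
      apply: Ae; apply: le_lt_trans xe.
      exact: (@abstract_norm_mono _ _ _ PS TS PSmono _ _ xi (leq_maxl p q)).
    apply: Bd; apply: le_lt_trans xd.
    exact: (@abstract_norm_mono _ _ _ PS TS PSmono _ _ xi (leq_maxr p q)).
  + move=> A B AB [p [e [e0 Ae]]]; exists p, e; split => // xi xe.
    exact/AB/Ae.
- move=> U [p [e [e0 Ue]]].
  exists [set xi : test_fun rapidly_decreasing | (normS p xi < e%:E)%E].
  by split; [exists p, e|exact: absconvS|].
- move=> U c [p [e [e0 Ue]]].
  have [d d0 H] := abstract_norm_scale PS0 TSlin p c e0.
  exists p, d; split=> // xi xd; apply: Ue.
  exact: (H _ (test_fun_smooth xi) xd).
- move=> U xi [p [e [e0 Ue]]].
  have [t t0 H] := abstract_norm_absorb PS0 TSlin e0 (test_fun_smooth xi)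
    ((test_funP xi).2 p).
  by exists t => //; exact: Ue.
Qed.

Let baseD : locally_convex_base (@test_nbhs0 compactly_supported).
Proof.
split.
- split.
  + by exists setT; split => // m _; exists 0%N, 1.
  + move=> A B [V [Vac VA HV]] [W [Wac WB HW]].
    exists (V `&` W); split.
    * by move=> a b xi eta ab [? ?] [? ?]; split; [exact: Vac|exact: Wac].
    * by move=> xi [/VA ? /WB ?].
    * move=> m m0; have [p [e [e0 Ve]]] := HV m m0.
      have [q [d [d0 Wd]]] := HW m m0.
      exists (maxn p q), (Num.min e d); split; first by rewrite lt_min e0.
      move=> xi xim; rewrite EFin_min lt_min => /andP[xe xd]; split.
        apply: Ve => //; apply: le_lt_trans xe.
        exact: (@abstract_norm_mono _ _ _ (PD m) TD (@PDmono m) _ _ xi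
          (leq_maxl p q)).
      apply: Wd => //; apply: le_lt_trans xd.
      exact: (@abstract_norm_mono _ _ _ (PD m) TD (@PDmono m) _ _ xi
          (leq_maxr p q)).
  + move=> A B AB [V [Vac VA HV]]; exists V; split => //.
    exact: subset_trans VA AB.
- move=> U [W [Wac WU HW]]; exists W; split => //.
  by exists W; split.
- move=> U c [W [Wac WU HW]].
  exists [set xi | W (c *: xi)]; split.
  + move=> a b xi eta ab /= Wxi Weta.
    have -> : c *: (a *: xi + b *: eta) = a *: (c *: xi) + b *: (c *: eta).
      by rewrite scalerDr !scalerA ![c * _]mulrC.
    exact: Wac.
  + by move=> xi /= /WU.
  + move=> m m0; have [p [e [e0 We]]] := HW m m0.
    have [d d0 H] := abstract_norm_scale (PD0 m) TDlin p c e0.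
    exists p, d; split => // xi xim xd; apply: We.
      by move=> x /xim H0; rewrite scale_valE H0 mulr0.
    exact: (H _ (test_fun_smooth xi) xd).
- move=> U xi [W [Wac WU HW]].
  have [_ [m m0 xim]] := test_funP xi.
  have [p [e [e0 We]]] := HW m m0.
  have [t t0 H] := abstract_norm_absorb (PD0 m) TDlin e0 (test_fun_smooth xi)
    (normD_fin m p (test_fun_smooth xi)).
  exists t => //; apply/WU/We => //.
  by move=> x /xim H0; rewrite scale_valE H0 mulr0.
Qed.

Lemma test_nbhs0_base E : locally_convex_base (@test_nbhs0 E).
Proof. by case: E; [exact: baseD|exact: baseS]. Qed.

HB.instance Definition _ E :=
  hasNbhs.Build (test_fun E) (nbhs_translate (@test_nbhs0 E)).

HB.instance Definition _ E := Nbhs_isNbhsTopological.Build (test_fun E)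
  (nbhs_translate_filter (test_nbhs0_base E))
  (nbhs_translate_singleton (test_nbhs0_base E))
  (nbhs_translate_nbhs (test_nbhs0_base E)).

Lemma nbhs0_test_funE E : nbhs (0 : test_fun E) = @test_nbhs0 E.
Proof.
apply/funext => A; rewrite /nbhs/= /nbhs_translate/=.
by congr test_nbhs0; apply/funext => h; rewrite /= add0r.
Qed.

Let test_add_continuous E :
  continuous (fun z : test_fun E * test_fun E => z.1 + z.2).
Proof.
move=> [x y] A /= /(nbhs_translate_add (test_nbhs0_base E))[B [D [xB yD BD]]].
by exists (B, D) => //= -[u v] [/= Bu Dv]; exact: BD.
Qed.

Let test_scale_continuous E :
  continuous (fun z : C^o * test_fun E => z.1 *: z.2).
Proof.
move=> [c x] A /= /(nbhs_translate_scale (test_nbhs0_base E))[d [B [d0 xB H]]].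
exists ([set e | `|c - e| < d], B); first by split => //; exists d.
by move=> [e u] [/= ce Bu]; exact: H.
Qed.

Let test_locally_convex E : exists2 B : set_system (test_fun E),
  (forall b, b \in B -> convex_set b) & basis B.
Proof.
exists [set b | open b /\ convex_set b]; first by move=> b /[!inE] -[].
split; first by move=> b [].
move=> x A /(nbhs_translate_convex (test_nbhs0_base E))[B [Bc Bo Bx BA]].
exists B => //; split => //; split; first exact: Bo.
move=> u v l /set_mem Bu /set_mem Bv; apply/mem_set.
exact: (Bc l%:num u v).
Qed.

HB.instance Definition _ E := PreTopologicalLmod_isTvs.Build C (test_fun E)
  (@test_add_continuous E) (@test_scale_continuous E) (@test_locally_convex E).

(* The factory above only provides the uniform structure. *)
HB.instance Definition _ E := PreTopologicalNmodule_isTopologicalNmodule.Build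
  (test_fun E) (@test_add_continuous E).
HB.instance Definition _ E := TopologicalNmodule_isTopologicalLmodule.Build
  C (test_fun E) (@test_scale_continuous E).
HB.instance Definition _ E := Uniform_isTvs.Build
  C (test_fun E) (@test_locally_convex E).

End test_functions.

Section demi_distributions.
Context (K : numFieldType).

(* C(0) *)
Definition class_C0 (gamma : K -> K) : Prop :=
  [/\ (gamma : K^o -> K^o) @ (0 : K^o) --> (0 : K^o), gamma 0 = 0 &
      forall t : K, `|t| <= 1 -> `|t| <= `|gamma t|].

Context (E : tvsType K).

(* E^(gamma, U) *)
Definition demi_distribution (gamma : K -> K) (U : set E) : set (E -> K) :=
  [set f | [/\ continuous (f : E -> K^o), f 0 = 0 &
    forall (x u : E) (t : K), U u -> `|t| <= 1 -> exists r s : K,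
      [/\ `|r - 1| <= `|gamma t|, `|s| <= `|gamma t| &
          f (x + t *: u) = r * f x + s * f u]]].

Definition linear_span (F : set (E -> K)) : set (E -> K) :=
  [set f | exists (m : nat) (c : 'I_m -> K) (g : 'I_m -> E -> K),
    (forall i, F (g i)) /\ f = (fun x => \sum_(i < m) c i * g i x)].

End demi_distributions.

Section convolution.
Context (R : realType) (n : nat) (E : test_space).
Local Notation C := R[i].
Local Notation testE := (test_fun R n E).

Definition convolution (f0 : {linear testE -> C^o}) (xi : testE) :
    'rV[R]_n -> C :=
  fun x => f0 (test_translate x xi).

Record convolution_multiplier (f0 : {linear testE -> C^o}) : Prop := {
  conv_is_test_fun : forall xi : testE, is_test_fun E (convolution f0 xi);
  conv_seq_cvg0 : forall xi : nat -> testE, xi @ \oo --> (0 : testE) ->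
    (fun j => make_test_fun (conv_is_test_fun (xi j))) @ \oo --> (0 : testE)
}.

Definition conv_test_fun (f0 : {linear testE -> C^o})
    (Hf0 : convolution_multiplier f0) (xi : testE) : testE :=
  make_test_fun (conv_is_test_fun Hf0 xi).

Definition conv_dist (f0 : {linear testE -> C^o})
    (Hf0 : convolution_multiplier f0) (f : testE -> C) : testE -> C :=
  fun xi => f (conv_test_fun Hf0 xi).

End convolution.

(* Main.v *)
Require Import Defs.
From HB Require Import structures.
From mathcomp Require Import all_boot all_order all_algebra.
From mathcomp Require Import all_classical all_reals all_analysis.
From mathcomp Require Import complex.

Import Order.TTheory GRing.Theory Num.Theory.
Import numFieldNormedType.Exports.

Local Open Scope classical_set_scope.
Local Open Scope ring_scope.

(** The map [T : xi |-> f0 * xi] is linear, and [f0 * f] is [f \o T].  Pulling a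
demi-distribution back along a continuous linear map [T] keeps the coefficients
[r] and [s] of the defining identity, because [T (x + t u) = T x + t T u]; it
only replaces [U] by [T^-1(U)].  So [V := T^-1(U)] works as soon as [T] is
continuous, and the statement on linear spans follows term by term.

A convolution multiplier is however only assumed to be sequentially continuous
at 0, and the space of compactly supported test functions is not first
countable.  The gap is closed by local convexity: in both spaces, an absolutely
convex set that eventually contains every null sequence is a neighborhood of 0
([nbhs0_absconv_seq]).  Indeed, in the inductive limit topology it suffices to
look at the trace of the set on each metrizable step, where a failure at every
scale yields a null sequence outside of the set.  Preimages under [T] of
absolutely convex neighborhoods of 0 are such sets, whence the continuity of
[T] ([linear_seq_continuous]). *)

Lemma le_normD (R : realType) (n m p q : nat) (f : 'rV[R]_n -> R[i]) :
  (p <= q)%N -> (normD m p f <= normD m q f)%E.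
Proof.
move=> pq; apply: ereal_sup_le => _ [i [ip im] <-].
by exists i => //; split => //; exact: leq_trans pq.
Qed.

Lemma le_normS (R : realType) (n p q : nat) (f : 'rV[R]_n -> R[i]) :
  (p <= q)%N -> (normS p f <= normS q f)%E.
Proof.
move=> pq; apply: ereal_sup_le => _ [i [ip iq] <-].
by exists i => //; split; [exact: leq_trans ip pq|exact: leq_trans iq pq].
Qed.

(** Both spaces are built from increasing sequences of norms [N].  Taking the
order of the norm and the inverse of the radius to be the same index [k] makes
the balls a countable base, so that a set containing none of them is missed by
a sequence [xi] that is eventually in each of them. *)
Lemma graded_norm_seq (T : Type) (R : realType) (D W : set T)
    (N : nat -> T -> \bar R) :
  (forall p q x, (p <= q)%N -> (N p x <= N q x)%E) ->
  (forall xi : nat -> T, (forall k, D (xi k)) ->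
    (forall p (e : R), 0 < e -> \forall k \near \oo, (N p (xi k) < e%:E)%E) ->
    exists k, W (xi k)) ->
  exists (p : nat) (e : R), 0 < e /\
    forall x, D x -> (N p x < e%:E)%E -> W x.
Proof.
move=> Nle NW; apply: contrapT => noball.
have /choice[xi xiP] (k : nat) : exists x,
    [/\ D x, (N k x < (k.+1%:R^-1)%:E)%E & ~ W x].
  apply: contrapT => nox; apply: noball; exists k, k.+1%:R^-1.
  split; first by rewrite invr_gt0.
  by move=> x Dx Nx; apply: contrapT => nWx; apply: nox; exists x.
have [|p e e0|k Wk] := NW xi; first by move=> k; have [] := xiP k.
  near=> k; have [_ Nk _] := xiP k.
  apply: le_lt_trans (Nle p k _ _) _; first by near: k; exact: nbhs_infty_ge.
  apply: (lt_trans Nk); rewrite lte_fin.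
  by near: k; exact: near_infty_natSinv_lt (PosNum e0).
by have [_ _] := xiP k.
Unshelve. all: by end_near. Qed.

(** The sequential form of being a bornological space.  For compactly supported
functions, absolute convexity reduces the claim to the trace of [W] on the
functions supported in a fixed ball; there, as for rapidly decreasing functions,
the topology is given by a sequence of norms.  A sequence that is null for the
norms of one such step is null in the inductive limit, so [W] meets it. *)
Lemma nbhs0_absconv_seq (R : realType) (n : nat) (E : test_space)
    (W : set (test_fun R n E)) :
  absolutely_convex W ->
  (forall xi : nat -> test_fun R n E, xi @ \oo --> (0 : test_fun R n E) ->
    \forall k \near \oo, W (xi k)) ->
  nbhs (0 : test_fun R n E) W.
Proof.
move=> Wac Wseq; rewrite nbhs0_test_funE.
(* [graded_norm_seq] only asks that W meet each null sequence *)
have Wmeet (xi : nat -> test_fun R n E) :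
    (forall A, test_nbhs0 (E := E) A -> \forall k \near \oo, A (xi k)) ->
    exists k, W (xi k).
  move=> xi0; have /filter_ex// : \forall k \near \oo, W (xi k).
  by apply: Wseq => A; rewrite nbhs0_test_funE; exact: xi0.
case: E W Wac Wmeet {Wseq} => W Wac Wmeet.
- exists W; split => // m m0.
  apply: (@graded_norm_seq (test_fun R n compactly_supported) _
    (fun xi => supported_in m xi) W (fun p xi => normD m p xi)) => [p q xi|xi xim xi0].
    exact: le_normD.
  apply: Wmeet => A [B [_ BA HB]]; have [p [e [e0 Be]]] := HB m m0.
  by apply: filterS (xi0 p e e0) => k xike; exact/BA/Be.
- have [||p [e [e0 We]]] :=
      @graded_norm_seq (test_fun R n rapidly_decreasing) _ setT W
        (fun p xi => normS p xi).
  + by move=> p q xi; exact: le_normS.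
  + move=> xi _ xi0; apply: Wmeet => A [p [e [e0 Ae]]].
    by apply: filterS (xi0 p e e0) => k; exact: Ae.
  + by exists p, e; split => // xi; exact: We.
Qed.

Lemma linear_map0 (K : pzRingType) (E F : lmodType K) (T : E -> F) :
  linear T -> T 0 = 0.
Proof. by move=> /(_ (-1) 0 0); rewrite !scaler0 addr0 scaleN1r addNr. Qed.

Lemma linear_seq_continuous (R : realType) (n : nat) (E F : test_space)
    (T : test_fun R n E -> test_fun R n F) :
  linear T ->
  (forall xi : nat -> test_fun R n E, xi @ \oo --> (0 : test_fun R n E) ->
    T \o xi @ \oo --> (0 : test_fun R n F)) ->
  continuous T.
Proof.
move=> Tlin Tseq.
have T0 := linear_map0 _ _ _ _ Tlin.
have TD x y : T (x + y) = T x + T y by have := Tlin 1 x y; rewrite !scale1r.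
have TZ a x : T (a *: x) = a *: T x by rewrite -[a *: x]addr0 Tlin T0 addr0.
have cvgT0 (A : set (test_fun R n F)) : nbhs (0 : test_fun R n F) A ->
    nbhs (0 : test_fun R n E) (T @^-1` A).
  rewrite nbhs0_test_funE => /(lcb_absconv (test_nbhs0_base R n F))[W [NW Wac WA]].
  apply: (@filterS _ _ _ (T @^-1` W)); first by move=> x /WA.
  apply: nbhs0_absconv_seq => [a b x y ab Wx Wy|xi xi0].
    by rewrite /preimage/= TD !TZ; exact: Wac.
  by apply: (Tseq xi xi0); rewrite nbhs0_test_funE.
(* neighborhoods of x are translates of neighborhoods of 0 *)
move=> x A TxA; rewrite /= /nbhs/= /nbhs_translate/=.
have := cvgT0 [set h | A (T x + h)]; rewrite !nbhs0_test_funE => /(_ TxA).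
by congr test_nbhs0; apply/funext => h /=; rewrite TD.
Qed.

Lemma demi_distribution_comp (K : numFieldType) (E F : tvsType K) (T : E -> F)
    (gamma : K -> K) (U : set F) (f : F -> K) :
  linear T -> continuous T ->
  demi_distribution gamma U f -> demi_distribution gamma (T @^-1` U) (f \o T).
Proof.
move=> Tlin Tcont; have T0 := linear_map0 _ _ _ _ Tlin.
move=> [fcont f0 fU]; split; last 2 first.
- by rewrite /= T0.
- move=> x u t Uu t1; have [r [s [rt st fE]]] := fU (T x) (T u) t Uu t1.
  by exists r, s; split => //=; rewrite addrC Tlin addrC.
- move=> x; apply: (@continuous_comp _ _ K^o T f); first exact: Tcont.
  exact: fcont.
Qed.

Lemma linear_span_comp (K : numFieldType) (E F : tvsType K) (T : E -> F)
    (P : set (F -> K)) (Q : set (E -> K)) :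
  (forall f, P f -> Q (f \o T)) ->
  forall f, linear_span P f -> linear_span Q (f \o T).
Proof.
by move=> PQ _ [m [c [g [Pg ->]]]]; exists m, c, (fun i => g i \o T); split;
  [move=> i; exact: PQ|].
Qed.

Lemma conv_test_fun_linear (R : realType) (n : nat) (E : test_space)
    (f0 : {linear test_fun R n E -> R[i]^o}) (mf0 : convolution_multiplier f0) :
  linear (conv_test_fun mf0).
Proof.
move=> a xi eta; apply/val_inj/funext => x /=; rewrite /convolution.
have -> : test_translate x (a *: xi + eta) =
    a *: test_translate x xi + test_translate x eta by exact/val_inj.
by rewrite linearP.
Qed.

Theorem theorem4p2 (R : realType) (n : nat) (hn : (0 < n)%N) (E : test_space)
    (gamma : R[i] -> R[i]) (hgamma : class_C0 gamma)
    (f0 : {linear test_fun R n E -> R[i]^o}) (hf0 : continuous f0)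
    (mf0 : convolution_multiplier f0)
    (U : set (test_fun R n E)) (hU : nbhs (0 : test_fun R n E) U) :
  exists V : set (test_fun R n E), [/\ nbhs (0 : test_fun R n E) V,
    forall f : test_fun R n E -> R[i],
      demi_distribution gamma U f -> demi_distribution gamma V (conv_dist mf0 f) &
    forall f : test_fun R n E -> R[i],
      linear_span (demi_distribution gamma U) f ->
      linear_span (demi_distribution gamma V) (conv_dist mf0 f)].
Proof.
have Tlin := conv_test_fun_linear _ _ _ _ mf0.
have Tcont : continuous (conv_test_fun mf0).
  by apply: linear_seq_continuous => //; exact: conv_seq_cvg0.
exists (conv_test_fun mf0 @^-1` U); split => //.
- by apply: (Tcont 0); rewrite (linear_map0 _ _ _ _ Tlin).
- by move=> f; exact: demi_distribution_comp.
- by apply: linear_span_comp => f; exact: demi_distribution_comp.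
Qed.
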